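(* Let $\Sigma$ be a mixing shift of finite type on a finite alphabet $S$. For any two shift-invariant Borel probability measures $\mu$ and $\nu$ on $\Sigma$, $$\bar d(\mu,\nu)=\sup\left\{\left|\int_\Sigma\phi\,d\mu-\int_\Sigma\phi\,d\nu\right| : \phi\in\Omega^{\mathsf{H}}\right\}.$$
   Context: $\mathbb{N}=\{1,2,\dots\}$, $S$ is a finite set, $S^{\mathbb{N}}$ carries the product topology, and the shift is $\sigma(x)_n=x_{n+1}$. A shift of finite type (SFT) is a set $\Sigma=\{x\in S^{\mathbb{N}}: A(x_n,x_{n+1})=1 \text{ for all } n\in\mathbb{N}\}$ for a transition matrix $A:S\times S\to\{0,1\}$. It is mixing if some power $A^n$, $n\in\mathbb{N}$, has all entries positive. A joining of shift-invariant measures $\mu,\nu$ on $\Sigma$ is a Borel probability measure $\theta$ on $\Sigma\times\Sigma$, invariant under $\sigma\times\sigma$, whose first and second marginals are $\mu$ and $\nu$. Ornstein's $\bar d$-distance is $\bar d(\mu,\nu)=\inf_\theta \theta(\{(x,y)\in\Sigma^2: x_1\ne y_1\})$, the infimum taken over all joinings $\theta$ of $\mu$ and $\nu$. For $n\in\mathbb{N}$ and $x,y\in\Sigma$ let $d^{\mathsf H}_n(x,y)=\frac1n\#\{i\in\{1,\dots,n\}: x_i\ne y_i\}$ (normalized Hamming pseudo-metric). $\Omega^{\mathsf H}_n$ is the set of functions $\phi:\Sigma\to\mathbb{R}$ with $|\phi(x)-\phi(y)|\le d^{\mathsf H}_n(x,y)$ for all $x,y\in\Sigma$, and $\Omega^{\mathsf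 H}=\bigcup_{n\in\mathbb{N}}\Omega^{\mathsf H}_n$. *)

(* Defs.v *)
From HB Require Import structures.
From mathcomp Require Import all_boot all_order all_algebra.
From mathcomp Require Import all_classical all_reals all_analysis.

Set Implicit Arguments.
Unset Strict Implicit.
Unset Printing Implicit Defensive.

Import Order.TTheory GRing.Theory Num.Theory.
Import numFieldNormedType.Exports.

Local Open Scope classical_set_scope.
Local Open Scope ring_scope.

(** Sequences are indexed from 0: [x n] is the coordinate written
    $x_{n+1}$ when indices start at 1. *)
Definition full_shift (S : finType) : topologicalType :=
  prod_topology (fun _ : nat => discrete_topology S).

Definition sft (S : finType) (A : S -> S -> bool) : set (full_shift S) :=
  [set x | forall n : nat, A (x n) (x n.+1)].

(** The natural-number entries matter: powers count paths. *)
Definition transition_mx (S : finType) (A : S -> S -> bool) : 'M[nat]_#|S| :=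
  \matrix_(i, j) (A (enum_val i) (enum_val j) : nat).

Definition mixing (S : finType) (A : S -> S -> bool) : Prop :=
  exists n : nat, (0 < n)%N /\
    forall i j : 'I_#|S|, (0 < (transition_mx A ^+ n) i j)%N.

(** The SFT as a space, with the subspace topology.  The point [x0] only serves
    as the default element that measurable types carry; a probability measure
    can only exist on an inhabited space. *)
Definition sft_space (S : finType) (A : S -> S -> bool) (x0 : sft A) : Type :=
  set_type (sft A).

#[warning="-redundant-canonical-projection"]
HB.instance Definition _ (S : finType) (A : S -> S -> bool) (x0 : sft A) :=
  Topological.copy (sft_space x0) (set_type (sft A)).
HB.instance Definition _ (S : finType) (A : S -> S -> bool) (x0 : sft A) :=
  isPointed.Build (sft_space x0) x0.

#[warning="-redundant-canonical-projection"]
HB.instance Definition _ (T U : ptopologicalType) := Pointed.on (T * U)%type.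

Definition borel (T : ptopologicalType) : measurableType (@open T).-sigma :=
  g_sigma_algebraType (@open T).

Section Shift.
Variables (S : finType) (A : S -> S -> bool) (x0 : sft A).

Definition letter (x : sft_space x0) (n : nat) : S := set_val x n.

Lemma sft_shift_subproof (x : sft_space x0) :
  ((fun n => letter x n.+1) : full_shift S) \in sft A.
Proof. by apply/mem_set => n; exact: (set_mem (valP x) n.+1). Qed.

Definition sft_shift (x : sft_space x0) : sft_space x0 :=
  exist (fun y => y \in sft A) _ (sft_shift_subproof x).

Definition sft_shift2 (z : sft_space x0 * sft_space x0) :
    sft_space x0 * sft_space x0 :=
  (sft_shift z.1, sft_shift z.2).

Variable R : realType.

Definition shift_invariant (mu : probability (borel (sft_space x0)) R) : Prop :=
  forall B : set (borel (sft_space x0)), measurable B ->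
    mu (sft_shift @^-1` B) = mu B.

(** The sigma-algebra on the square is the Borel one of the product topology. *)
Definition is_joining (mu nu : probability (borel (sft_space x0)) R)
    (theta : probability (borel (sft_space x0 * sft_space x0)%type) R) : Prop :=
  [/\ forall B : set (borel (sft_space x0 * sft_space x0)%type),
        measurable B -> theta (sft_shift2 @^-1` B) = theta B,
      forall B : set (borel (sft_space x0)),
        measurable B -> theta (fst @^-1` B) = mu B
    & forall B : set (borel (sft_space x0)),
        measurable B -> theta (snd @^-1` B) = nu B].

Definition dbar (mu nu : probability (borel (sft_space x0)) R) : \bar R :=
  ereal_inf [set theta [set z | letter z.1 0%N != letter z.2 0%N]
            | theta in is_joining mu nu].

Definition hamming (n : nat) (x y : sft_space x0) : R :=
  n%:R^-1 * #|[set i : 'I_n | letter x i != letter y i]%SET|%:R.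

Definition Omega (n : nat) : set (sft_space x0 -> R) :=
  [set phi | forall x y, `|phi x - phi y| <= hamming n x y].

Definition OmegaH : set (sft_space x0 -> R) :=
  \bigcup_(n in [set n : nat | (0 < n)%N]) Omega n.

End Shift.

Arguments OmegaH {S A} x0 R.

(* Main.v *)
(** Weak duality: along an invariant coupling [theta], the mean of the
    normalized Hamming distance of order [n] is the measure of the event that
    the first letters differ, and it bounds the difference of the means of any
    function that is 1-Lipschitz for that distance.

    Conversely, let [s] be the supremum on the right-hand side. On bounded
    functions [F] of two points consider the infimum [p F] of
    [int u dmu + int v dnu + t s] over all [u], [v], [G] and [t >= 0] with
    [F + G o T - G <= u(x) + v(y) + t 1_{x_1 <> y_1}], where [T] is the product
    shift. This [p] is sublinear and finite, the point being that it is
    nonnegative at [0] (lemma [dual_ge0]). A linear functional below [p], given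
    by the Hahn-Banach theorem, is a finitely additive invariant coupling of
    [mu] and [nu] whose cost is at most [s]. Restricted to sets depending on
    finitely many letters it is countably additive by compactness, and its
    Caratheodory extension is the joining sought. *)

Require Import Defs.
From HB Require Import structures.
From mathcomp Require Import all_boot all_order all_algebra.
From mathcomp Require Import all_classical all_reals all_analysis.
From mathcomp Require Import measurable_realfun lra.

Set Implicit Arguments.
Unset Strict Implicit.
Unset Printing Implicit Defensive.

Import Order.TTheory GRing.Theory Num.Theory.
Import numFieldNormedType.Exports.

Local Open Scope classical_set_scope.
Local Open Scope ring_scope.

(** * Hahn-Banach *)

(** Homogeneity is asked as an inequality; for [a > 0] the reverse one follows by rescaling with
    [a^-1]. *)
Definition sublinear (R : realType) (V : lmodType R) (q : V -> R) : Prop :=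
  (forall x y, q (x + y) <= q x + q y) /\
  (forall a x, 0 <= a -> q (a *: x) <= a * q x).

Section HahnBanach.
Context (R : realType) (V : lmodType R).
Implicit Types (q : V -> R) (x y : V) (a t : R).

Lemma sublinear0 q : sublinear q -> q 0 = 0.
Proof.
move=> [qD qZ]; have := qD 0 0; have := qZ 0 0 (lexx 0).
by rewrite scaler0 mul0r addr0; lra.
Qed.

Lemma sublinear_ge q x : sublinear q -> - q (- x) <= q x.
Proof.
move=> sq; have := sq.1 x (- x); rewrite subrr (sublinear0 sq); lra.
Qed.

Lemma sublinearZ q a x : sublinear q -> 0 <= a -> q (a *: x) = a * q x.
Proof.
move=> sq; rewrite le0r => /predU1P[->|a0].
  by rewrite scale0r mul0r (sublinear0 sq).
apply/eqP; rewrite eq_le (sq.2 _ _ (ltW a0)) /=.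
have := sq.2 a^-1 (a *: x); rewrite scalerA mulVf ?gt_eqF// scale1r.
rewrite invr_ge0 ltW// => /(_ isT).
by rewrite ler_pdivlMl.
Qed.

Lemma le_mul_inf (A : set R) a c : 0 <= a -> has_inf A ->
  (forall t, A t -> c <= a * t) -> c <= a * inf A.
Proof.
move=> + [A0 lA]; rewrite le0r => /predU1P[->|a0] cA.
  by case: A0 => t /cA; rewrite !mul0r.
rewrite -ler_pdivrMl//; apply: lb_le_inf => // t At.
by rewrite ler_pdivrMl// cA.
Qed.

(** The witness is the pointwise infimum, finite because [- p (- x)] bounds every member from below
    at [x]. It is subadditive because, of two members of the chain, the smaller one can serve at
    both points. *)
Lemma sublinear_chain (p : V -> R) (B : set (V -> R)) : B !=set0 ->
  (forall q, B q -> sublinear q /\ forall x, q x <= p x) ->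
  (forall q q', B q -> B q' ->
    (forall x, q x <= q' x) \/ (forall x, q' x <= q x)) ->
  exists r, [/\ sublinear r, forall x, r x <= p x
    & forall q, B q -> forall x, r x <= q x].
Proof.
move=> [q0 Bq0] Bp Btot.
pose r x := inf [set q x | q in B].
have hr x : has_inf [set q x | q in B].
  split; first by exists (q0 x), q0.
  exists (- p (- x)) => _ [q Bq <-]; have [sq qp] := Bp _ Bq.
  by rewrite (le_trans _ (sublinear_ge x sq))// lerN2.
have rB q : B q -> forall x, r x <= q x.
  by move=> Bq x; apply: ge_inf; [case: (hr x)|exists q].
exists r; split => //; last by move=> x; rewrite (le_trans (rB _ Bq0 x))// (Bp _ Bq0).2.
split=> [x y|a x a0].
  have rxy q1 q2 : B q1 -> B q2 -> r (x + y) <= q1 x + q2 y.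
    move=> B1 B2; have [le12|le21] := Btot _ _ B1 B2.
      by rewrite (le_trans (rB _ B1 _))// (le_trans ((Bp _ B1).1.1 _ _))// lerD2l.
    by rewrite (le_trans (rB _ B2 _))// (le_trans ((Bp _ B2).1.1 _ _))// lerD2r.
  rewrite -lerBlDr; apply: lb_le_inf; first by case: (hr x).
  move=> _ [q1 B1 <-]; rewrite lerBlDr -lerBlDl.
  apply: lb_le_inf; first by case: (hr y).
  by move=> _ [q2 B2 <-]; rewrite lerBlDl rxy.
apply: le_mul_inf => // _ [q Bq <-].
by rewrite (le_trans (rB _ Bq _))// (Bp _ Bq).1.2.
Qed.

(* Each [x |-> inf_t (q (x + t y) - t q y)] is sublinear and below [q]. *)
Lemma minimal_sublinear_additive q : sublinear q ->
  (forall r, sublinear r -> (forall x, r x <= q x) -> r = q) ->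
  {morph q : x y / x + y}.
Proof.
move=> sq qmin x0 y.
pose D x := [set q (x + t *: y) - t * q y | t in [set t | 0 <= t]].
have hD x : has_inf (D x).
  split; first by exists (q (x + 0 *: y) - 0 * q y), 0 => /=.
  exists (- q (- x)) => _ [t /= t0 <-].
  have := sq.1 (x + t *: y) (- x).
  by rewrite addrAC subrr add0r (sublinearZ _ sq t0); lra.
pose r x := inf (D x).
have rD x t : 0 <= t -> r x <= q (x + t *: y) - t * q y.
  by move=> t0; apply: ge_inf; [case: (hD x)|exists t].
have rq x : r x <= q x.
  by have := rD x 0 (lexx _); rewrite scale0r addr0 mul0r subr0.
suff sr : sublinear r.
  apply/eqP; rewrite eq_le sq.1 /=.
  have := rD x0 1 ler01; rewrite (qmin _ sr rq) scale1r mul1r; lra.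
split=> [x1 x2|a x a0].
  rewrite -lerBlDr; apply: lb_le_inf; first by case: (hD x1).
  move=> _ [t1 /= t10 <-]; rewrite lerBlDr -lerBlDl.
  apply: lb_le_inf; first by case: (hD x2).
  move=> _ [t2 /= t20 <-].
  have := rD (x1 + x2) _ (addr_ge0 t10 t20).
  have := sq.1 (x1 + t1 *: y) (x2 + t2 *: y).
  by rewrite addrACA -scalerDl; lra.
apply: le_mul_inf => // _ [t /= t0 <-].
have := rD (a *: x) _ (mulr_ge0 a0 t0).
by rewrite -scalerA -scalerDr (sublinearZ _ sq a0); lra.
Qed.

(** Zorn's lemma gives a minimal sublinear functional below [p], and minimality forces additivity;
    no extension from subspaces is involved. *)
Theorem hahn_banach (p : V -> R) : sublinear p ->
  exists f : V -> R, [/\ {morph f : x y / x + y},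
    forall a x, f (a *: x) = a * f x & forall x, f x <= p x].
Proof.
move=> sp.
pose T := {q : V -> R | sublinear q /\ forall x, q x <= p x}.
(* The order is reversed, so that a maximal element is a minimal functional. *)
pose R' (s t : T) := `[< forall x, sval t x <= sval s x >].
have [||||q qmax] := @Zorn T R'.
- by move=> t; apply/asboolP.
- move=> r s t /asboolP rs /asboolP st; apply/asboolP => x.
  exact: le_trans (st x) (rs x).
- move=> s t /asboolP st /asboolP ts; apply: eq_sig_hprop => [q|]; first exact: Prop_irrelevance.
  apply/funext => x.
  by apply/eqP; rewrite eq_le ts st.
- move=> A Atot; have [A0|/set0P/negP/negPn/eqP A0] := pselect (A !=set0); last first.
    by exists (exist _ p (conj sp (fun=> lexx _))) => s; rewrite A0.
  have [|||r [sr rp rA]] := @sublinear_chain p [set sval s | s in A].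
  + by case: A0 => s As; exists (sval s), s.
  + by move=> _ [s _ <-]; exact: svalP s.
  + move=> _ _ [s As <-] [t At <-].
    by have [/asboolP|/asboolP] := Atot s t As At; [right|left].
  by exists (exist _ r (conj sr rp)) => s As; apply/asboolP => x; apply: rA; exists s.
have [sq qp] := svalP q.
have qD : {morph sval q : x y / x + y}.
  apply: minimal_sublinear_additive => // r sr rq.
  have rp x : r x <= p x by exact: le_trans (rq x) (qp x).
  by have /(congr1 sval) := qmax (exist _ r (conj sr rp)) (asboolT rq).
exists (sval q); split => // a x.
have qN y : sval q (- y) = - sval q y.
  by apply/eqP; rewrite -addr_eq0 -qD addNr (sublinear0 sq).
have [a0|a0] := leP 0 a; first exact: sublinearZ.
apply: oppr_inj; rewrite -qN -scaleNr -mulNr; apply: sublinearZ => //.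
by rewrite oppr_ge0 ltW.
Qed.

End HahnBanach.

(** * Sets depending on finitely many letters *)

Section Determined.
Context (T : pointedType) (W : finType) (code : T -> nat -> W).
Implicit Types (B : set T) (x y : T) (n : nat).

Definition agree n x y : Prop := forall i, (i < n)%N -> code x i = code y i.

(** As [W] is finite, these are the finite unions of cylinders of the coding. An abstract [code]
    serves both for points and for pairs of points. *)
Definition determined : set (set T) :=
  [set B | exists n, forall x y, agree n x y -> B x -> B y].

Lemma agree_sym n x y : agree n x y -> agree n y x.
Proof. by move=> xy i /xy. Qed.

Lemma agree_le m n x y : (m <= n)%N -> agree n x y -> agree m x y.
Proof. by move=> mn xy i im; exact/xy/(leq_trans im). Qed.

Lemma agree_trans n x y z : agree n x y -> agree n y z -> agree n x z.
Proof. by move=> xy yz i ni; rewrite xy// yz. Qed.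

Lemma determined0 : determined set0.
Proof. by exists 0%N. Qed.

Lemma determinedC : setC_closed determined.
Proof.
by move=> B [n nB]; exists n => x y xy; apply: contra_not; exact/nB/agree_sym.
Qed.

Lemma determinedU : setU_closed determined.
Proof.
move=> A B [m mA] [n nB]; exists (maxn m n) => x y xy [Ax|Bx]; [left|right].
  by apply: mA Ax; apply: agree_le xy; exact: leq_maxl.
by apply: nB Bx; apply: agree_le xy; exact: leq_maxr.
Qed.

Lemma determinedI : setI_closed determined.
Proof.
move=> A B dA dB; rewrite -[A `&` B]setCK setCI.
by apply: determinedC; apply: determinedU; apply: determinedC.
Qed.

Lemma determinedD : setD_closed determined.
Proof. by move=> A B dA dB; rewrite setDE; apply: determinedI => //; exact: determinedC. Qed.

Lemma determined_bigsetU (F : nat -> set T) n : (forall i, determined (F i)) ->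
  determined (\big[setU/set0]_(i < n) F i).
Proof.
by move=> dF; elim/big_ind: _ => //; [exact: determined0|exact: determinedU].
Qed.

(** The set of codes is closed, hence compact, in the product of copies of the finite discrete space
    [W]. *)
Definition code_complete : Prop := forall p : nat -> W,
  (forall n, exists x, forall i, (i < n)%N -> code x i = p i) ->
  exists x, forall i, code x i = p i.

(* Along an ultrafilter on the indices, the codes of points chosen in the sets
   converge coordinatewise. *)
Lemma determined_bigcap (B : nat -> set T) : code_complete ->
  (forall n, determined (B n)) -> (forall m n, (m <= n)%N -> B n `<=` B m) ->
  (forall n, B n !=set0) -> exists x, forall n, B n x.
Proof.
move=> cc dB Bdec /choice[z Bz].
have [F [FU ooF]] := @ultraFilterLemma nat \oo _.
have /choice[p Fp] i : exists w, F [set n | code (z n) i = w].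
  apply: contrapT => /forallNP nF.
  have {}nF w : F [set n | code (z n) i <> w].
    by have [/(nF w)//|] := in_ultra_setVsetC [set n | code (z n) i = w] FU.
  (* There are finitely many letters, so the intersection over [w] of members of [F] is still in
     [F]. *)
  have /filter_ex[n /=] : \forall n \near F, forall w, code (z n) i <> w.
    exact: filter_forall.
  by move/(_ (code (z n) i)).
have Fp' n : F [set m | forall i, (i < n)%N -> code (z m) i = p i].
  elim: n => [|n IH]; first by apply: filterS filterT => m _ i.
  apply: filterS2 IH (Fp n) => m IH mn i.
  by rewrite ltnS leq_eqVlt => /predU1P[->//|/IH].
have [|x xp] := cc p.
  by move=> n; have /filter_ex[m zm] := Fp' n; exists (z m).
exists x => n; have [k kB] := dB n.
have /filter_ex[m [/= zm nm]] : F ([set m | forall i, (i < k)%N -> code (z m) i = p i]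
    `&` [set m | (n <= m)%N]).
  by apply: filterI (Fp' k) _; apply: ooF; exists n.
apply: (kB (z m)); first by move=> i ik; rewrite zm// xp.
exact: Bdec (Bz m).
Qed.

(** Without a finite subcover, the parts of [A] left uncovered by the first [n] sets are nonempty
    and decreasing, so they share a point, which no [F n] contains. *)
Lemma determined_cover (A : set T) (F : nat -> set T) : code_complete ->
  determined A -> (forall n, determined (F n)) -> A `<=` \bigcup_n F n ->
  exists n, A `<=` \big[setU/set0]_(i < n) F i.
Proof.
move=> cc dA dF AF; apply: contrapT => /forallNP nAF.
have [|m n mn x [Ax nx]|n|x Bx] :=
  @determined_bigcap (fun n => A `\` \big[setU/set0]_(i < n) F i) cc.
- by move=> n; exact/determinedD/determined_bigsetU.
- by split=> //; apply: contra_not nx; exact: (subset_bigsetU mn).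
- by apply/set0P/negP => /eqP; rewrite setD_eq0; exact: nAF.
- have [n _ Fnx] := AF x (Bx 0%N).1.
  by apply: (Bx n.+1).2; rewrite big_ord_recr/=; right.
Qed.

End Determined.

(** [code] is a phantom parameter: the alias carries the algebra of determined sets, while [T] may
    keep a sigma-algebra of its own. *)
Definition determined_space (T : pointedType) (W : finType)
  (code : T -> nat -> W) : Type := T.

HB.instance Definition _ (T : pointedType) (W : finType)
  (code : T -> nat -> W) := Pointed.on (determined_space code).

HB.instance Definition _ (T : pointedType) (W : finType)
    (code : T -> nat -> W) :=
  @isAlgebraOfSets.Build default_measure_display (determined_space code)
    (determined code) (determined0 code) (@determinedU _ _ code)
    (@determinedC _ _ code).

(** * Extension of finitely additive contents to probability measures *)

Section ContentExtension.
Context (R : realType) d (T : measurableType d) (W : finType).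
Variable code : T -> nat -> W.
Variable m : set T -> R.
Hypotheses (m_ge0 : forall A, 0 <= m A) (mT : m setT = 1)
  (mU : forall A B, A `&` B = set0 -> m (A `|` B) = m A + m B)
  (cc : code_complete code)
  (mE : @measurable d T = <<s determined code>>).

Lemma content_set0 : m set0 = 0.
Proof. by have := mU (setI0 set0); rewrite setU0; lra. Qed.

Lemma content_le A B : A `<=` B -> m A <= m B.
Proof. by move=> AB; rewrite -(setDUK AB) mU ?lerDl// setDIK. Qed.

Lemma content_le_bigsetU (F : nat -> set T) n :
  m (\big[setU/set0]_(i < n) F i) <= \sum_(i < n) m (F i).
Proof.
elim: n => [|n IH]; first by rewrite !big_ord0 content_set0.
rewrite !big_ord_recr/=; set A := \big[_/_]_(_ < _) _ in IH *.
have <- : A `|` ((A `|` F n) `\` A) = A `|` F n by rewrite setDUK//; exact: subsetUl.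
by rewrite mU ?setDIK// lerD// content_le// => x [[]].
Qed.

Definition determined_content (A : set (determined_space code)) : \bar R :=
  (m A)%:E.

Lemma determined_content_ge0 A : (0 <= determined_content A)%E.
Proof. by rewrite lee_fin. Qed.

Lemma determined_content_semi_additive :
  measure_function.semi_additive determined_content.
Proof.
move=> F n _ tF _; rewrite /determined_content sumEFin; congr (_%:E).
elim: n => [|n IH]; first by rewrite !big_ord0 content_set0.
rewrite !big_ord_recr/= mU ?IH// (@trivIset_bigsetUI _ xpredT)//.
by rewrite [X in trivIset X F](_ : _ = [set: nat])//; exact/seteqP.
Qed.

HB.instance Definition _ := isContent.Build _ _ R determined_content
  determined_content_ge0 determined_content_semi_additive.

(** By compactness a countable cover has a finite subcover, so finite subadditivity suffices; the
    series dominates its partial sums. *)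
Lemma determined_content_sigma_subadditive :
  measurable_subset_sigma_subadditive determined_content.
Proof.
move=> A F dF dA AF; have [n An] := determined_cover cc dA dF AF.
apply: (@le_trans _ _ (\sum_(0 <= i < n) determined_content (F i)))%E.
  rewrite big_mkord sumEFin lee_fin.
  exact: le_trans (content_le An) (content_le_bigsetU _ _).
by apply: nneseries_lim_ge => i _ _; exact: determined_content_ge0.
Qed.

HB.instance Definition _ := Content_SigmaSubAdditive_isMeasure.Build _ R _
  determined_content determined_content_sigma_subadditive.


Let M : {measure set (determined_space code) -> \bar R} := determined_content.

(** The Caratheodory extension, seen as a function on subsets of [T]; [mE] identifies the
    sigma-algebra of [T] with the one generated by the determined sets. *)
Definition extended_content : set T -> \bar R := measure_extension M.

Lemma extended_content0 : extended_content set0 = 0%E.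
Proof. exact: (measure0 (measure_extension M)). Qed.

Lemma extended_content_ge0 A : (0 <= extended_content A)%E.
Proof. exact: (measure_ge0 (measure_extension M)). Qed.

Lemma extended_content_sigma_additive :
  measure_function.semi_sigma_additive extended_content.
Proof.
move=> F mF tF mUF.
apply: (@measure_semi_sigma_additive _ _ _ (measure_extension M)) => //.
- by move=> i; have := mF i; rewrite mE.
- by move: mUF; rewrite mE.
Qed.

HB.instance Definition _ := isMeasure.Build _ _ _ extended_content
  extended_content0 extended_content_ge0 extended_content_sigma_additive.

Lemma extended_contentE A : determined code A -> extended_content A = (m A)%:E.
Proof. by move=> dA; exact: (measurable_mu_extE M dA). Qed.

Lemma extended_content_setT : extended_content setT = 1%E.
Proof. by rewrite extended_contentE ?mT//; exists 0%N. Qed.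

HB.instance Definition _ := Measure_isProbability.Build _ _ _
  extended_content extended_content_setT.

Lemma content_extension :
  exists P : probability T R, forall A, determined code A -> P A = (m A)%:E.
Proof. by exists extended_content => A; exact: extended_contentE. Qed.

End ContentExtension.

(** * Topology of subshifts *)

Lemma open_determined (T : ptopologicalType) (W : finType)
    (code : T -> nat -> W) (B : set T) :
  (forall i w, open [set x | code x i = w]) -> determined code B -> open B.
Proof.
move=> oc [n nB]; rewrite openE => x Bx.
have : nbhs x [set y | forall i : 'I_n, code y i = code x i].
  apply: filter_forall => i.
  by apply: open_nbhs_nbhs; split => //; exact: (oc i (code x i)).
apply: filterS => y yx; apply: nB Bx => i ni.
by rewrite (yx (Ordinal ni)).
Qed.

(** An open [U] is the countable union over [n] of the determined sets of points whose whole
    cylinder of order [n] lies in [U]. *)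
Lemma borel_determined (T : ptopologicalType) (W : finType)
    (code : T -> nat -> W) :
  (forall i w, open [set x | code x i = w]) ->
  (forall x U, nbhs x U -> exists n, forall y, agree code n x y -> U y) ->
  @measurable _ (borel T) = <<s determined code >>.
Proof.
move=> oc nc; apply/seteqP; split.
  apply: smallest_sub; first exact: smallest_sigma_algebra.
  move=> U oU; pose Un n := [set x | forall y, agree code n x y -> U y].
  have -> : U = \bigcup_n Un n.
    apply/seteqP; split=> [x Ux|x [n _]]; last exact.
    by have [n nU] := nc x U (open_nbhs_nbhs (conj oU Ux)); exists n.
  apply: sigma_algebra_bigcup => n; apply: sub_gen_smallest.
  by exists n => x y xy Unx z yz; apply: Unx; exact: agree_trans yz.
apply: smallest_sub; first exact: smallest_sigma_algebra.
move=> B dB; apply: sub_gen_smallest; exact: open_determined oc dB.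
Qed.

Section Sft.
Context (S : finType) (A : S -> S -> bool) (x0 : sft A).
Local Notation X := (sft_space x0).
Implicit Types (x y : X).

Lemma continuous_letter i :
  continuous ((fun x => letter x i) : X -> discrete_topology S).
Proof.
move=> x; apply: (@continuous_comp X (full_shift S) (discrete_topology S)
  set_val (@proj nat (fun=> discrete_topology S) i)).
  exact: initial_continuous.
exact: proj_continuous.
Qed.

Lemma open_letter i (w : S) : open [set x : X | letter x i = w].
Proof.
have := @open_comp X (discrete_topology S) _ [set w].
move=> /(_ (fun x => letter x i)); apply; last exact: discrete_open.
by move=> x _; exact: continuous_letter.
Qed.

Lemma nbhs_letter x (U : set X) : nbhs x U ->
  exists n, forall y, agree (@letter S A x0) n x y -> U y.
Proof.
move=> [_ /= [[V oV <-] Vx] VU].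
pose cyl n := [set y : full_shift S | forall i, (i < n)%N -> letter x i = y i].
pose F : set_system (full_shift S) := filter_from setT cyl.
have FF : Filter F.
  apply: filter_from_filter; first by exists 0%N.
  move=> m n _ _; exists (maxn m n) => // y xy; split=> i ilt; apply: xy.
    exact: leq_trans (leq_maxl _ _).
  exact: leq_trans (leq_maxr _ _).
(* The product topology is a supremum of initial topologies, so convergence of the filter of
   cylinders is checked one coordinate at a time. *)
have : F --> (set_val x : full_shift S).
  apply/cvg_sup => i B [_ /= [[V' oV' <-] V'x] V'B].
  exists i.+1 => // y xy; apply: V'B => /=.
  by have := xy i (ltnSn i); rewrite /= /proj => <-.
move=> /(_ V) [|n _ nV]; first exact: open_nbhs_nbhs.
by exists n => y xy; apply: VU; apply: nV.
Qed.

Lemma letter_complete : code_complete (@letter S A x0).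
Proof.
move=> p pE.
have Ap : (p : full_shift S) \in sft A.
  (* The transition at [n] reads the letters [n] and [n.+1], hence a prefix of length [n.+2]. *)
  apply/mem_set => n; have [x xp] := pE n.+2.
  by rewrite -(xp n)// -(xp n.+1)//; exact: (set_mem (valP x) n).
by exists (exist (fun u => u \in sft A) _ Ap).
Qed.

Definition letter2 (z : X * X) i : S * S := (letter z.1 i, letter z.2 i).

Lemma agree_letter2 n z z' : agree letter2 n z z' <->
  agree (@letter S A x0) n z.1 z'.1 /\ agree (@letter S A x0) n z.2 z'.2.
Proof.
split=> [zz|[z1 z2] i ni]; last by rewrite /letter2 z1// z2.
by split=> i /zz [].
Qed.

Lemma open_letter2 i w : open [set z : X * X | letter2 z i = w].
Proof.
rewrite openE => z zw; exists ([set x | letter x i = w.1], [set x | letter x i = w.2]) => /=.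
  by split; apply: open_nbhs_nbhs; split; rewrite -?zw//; exact: open_letter.
by move=> [x y] [/= xw yw]; rewrite /letter2/= xw yw -surjective_pairing.
Qed.

Lemma nbhs_letter2 z (U : set (X * X)) : nbhs z U ->
  exists n, forall z', agree letter2 n z z' -> U z'.
Proof.
move=> [[V1 V2] [/= /nbhs_letter[m mV] /nbhs_letter[n nV]] VU].
exists (maxn m n) => z' /agree_letter2[z1 z2]; apply: VU; split => /=.
  by apply: mV; exact: agree_le (leq_maxl _ _) z1.
by apply: nV; exact: agree_le (leq_maxr _ _) z2.
Qed.

Lemma letter2_complete : code_complete letter2.
Proof.
move=> p pE.
have [n|x xp] := letter_complete (p := fun i => (p i).1).
  by have [z zp] := pE n; exists z.1 => i ni; rewrite -zp.
have [n|y yp] := letter_complete (p := fun i => (p i).2).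
  by have [z zp] := pE n; exists z.2 => i ni; rewrite -zp.
by exists (x, y) => i; rewrite /letter2/= xp yp -surjective_pairing.
Qed.

Lemma measurable_letterE :
  @measurable _ (borel X) = <<s determined (@letter S A x0) >>.
Proof. exact: borel_determined open_letter nbhs_letter. Qed.

Lemma measurable_letter2E :
  @measurable _ (borel (X * X)%type) = <<s determined letter2 >>.
Proof. exact: borel_determined open_letter2 nbhs_letter2. Qed.

Lemma determined_shift (B : set X) : determined (@letter S A x0) B ->
  determined (@letter S A x0) (@sft_shift S A x0 @^-1` B).
Proof.
by move=> [n nB]; exists n.+1 => x y xy; apply: nB => i ni; apply: xy.
Qed.

Lemma determined_shift2 (B : set (X * X)) : determined letter2 B ->
  determined letter2 (@sft_shift2 S A x0 @^-1` B).
Proof.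
by move=> [n nB]; exists n.+1 => z z' zz; apply: nB => i ni; apply: (zz i.+1).
Qed.

Lemma determined_fst (B : set X) : determined (@letter S A x0) B ->
  determined letter2 (fst @^-1` B).
Proof.
by move=> [n nB]; exists n => z z' /agree_letter2[zz _]; exact: nB.
Qed.

Lemma determined_snd (B : set X) : determined (@letter S A x0) B ->
  determined letter2 (snd @^-1` B).
Proof.
by move=> [n nB]; exists n => z z' /agree_letter2[_ zz]; exact: nB.
Qed.

End Sft.

Lemma determined_measurable_fun d d' (T : measurableType d)
    (T' : measurableType d') (W W' : finType) (code : T -> nat -> W)
    (code' : T' -> nat -> W') (f : T -> T') :
  @measurable _ T = <<s determined code >> ->
  @measurable _ T' = <<s determined code' >> ->
  (forall B, determined code' B -> determined code (f @^-1` B)) ->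
  measurable_fun setT f.
Proof.
move=> mT mT' df; apply: (@measurability _ _ T T' setT f (determined code') mT').
move=> _ [B dB <-]; rewrite setTI mT; apply: sub_gen_smallest; exact: df.
Qed.

Section SftMeasurable.
Context (S : finType) (A : S -> S -> bool) (x0 : sft A).
Local Notation X := (borel (sft_space x0)).
Local Notation Z := (borel (sft_space x0 * sft_space x0)%type).

Lemma measurable_shift : measurable_fun setT (@sft_shift S A x0 : X -> X).
Proof.
exact: determined_measurable_fun (measurable_letterE x0) (measurable_letterE x0)
  (@determined_shift S A x0).
Qed.

Lemma measurable_shift2 : measurable_fun setT (@sft_shift2 S A x0 : Z -> Z).
Proof.
exact: determined_measurable_fun (measurable_letter2E x0)
  (measurable_letter2E x0) (@determined_shift2 S A x0).
Qed.

Lemma measurable_sft_fst : measurable_fun setT (fst : Z -> X).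
Proof.
exact: determined_measurable_fun (measurable_letter2E x0)
  (measurable_letterE x0) (@determined_fst S A x0).
Qed.

Lemma measurable_sft_snd : measurable_fun setT (snd : Z -> X).
Proof.
exact: determined_measurable_fun (measurable_letter2E x0)
  (measurable_letterE x0) (@determined_snd S A x0).
Qed.

End SftMeasurable.

(** * Bounded measurable functions *)

Definition bounded_measurable d (T : measurableType d) (R : realType)
    (u : T -> R) : Prop :=
  measurable_fun setT u /\ exists M, forall x, `|u x| <= M.

Section BoundedMeasurable.
Context (R : realType) d (T : measurableType d) (P : probability T R).
Implicit Types (u v : T -> R).

Lemma bounded_measurable_integrable u : bounded_measurable u ->
  P.-integrable setT (EFin \o u).
Proof.
move=> [mu [M uM]]; apply: measurable_bounded_integrable => //.
  by rewrite (le_lt_trans (probability_le1 _ _))// ltry.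
by exists M; split; [exact: num_real|move=> N MN x _; exact: le_trans (ltW MN)].
Qed.

Lemma bounded_measurable_cst (r : R) : bounded_measurable (fun _ : T => r).
Proof. by split; [exact: measurable_cst|exists `|r|]. Qed.

Lemma bounded_measurableD u v : bounded_measurable u -> bounded_measurable v ->
  bounded_measurable (fun x => u x + v x).
Proof.
move=> [mu [M uM]] [mv [N vN]]; split; first exact: measurable_funD.
by exists (M + N) => x; rewrite (le_trans (ler_normD _ _))// lerD.
Qed.

Lemma bounded_measurableZ (a : R) u : bounded_measurable u ->
  bounded_measurable (fun x => a * u x).
Proof.
move=> [mu [M uM]]; split; first exact: measurable_funM.
by exists (`|a| * M) => x; rewrite normrM ler_wpM2l.
Qed.

Lemma bounded_measurable_sum (u : nat -> T -> R) n :
  (forall i, bounded_measurable (u i)) ->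
  bounded_measurable (fun x => \sum_(i < n) u i x).
Proof.
move=> bu; elim: n => [|n IH].
  by under eq_fun do rewrite big_ord0; exact: bounded_measurable_cst.
by under eq_fun do rewrite big_ord_recr; exact: bounded_measurableD.
Qed.

Lemma mean_cst (r : R) : \int[P]_x r = r.
Proof.
by rewrite Rintegral_cst// -[RHS]mulr1; congr (r * _);
  exact: (congr1 fine (probability_setT P)).
Qed.

Lemma meanD u v : bounded_measurable u -> bounded_measurable v ->
  \int[P]_x (u x + v x) = \int[P]_x u x + \int[P]_x v x.
Proof. by move=> bu bv; rewrite RintegralD//; exact: bounded_measurable_integrable. Qed.

Lemma meanZ (a : R) u : bounded_measurable u ->
  \int[P]_x (a * u x) = a * \int[P]_x u x.
Proof. by move=> bu; rewrite RintegralZl//; exact: bounded_measurable_integrable. Qed.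

Lemma le_mean u v : bounded_measurable u -> bounded_measurable v ->
  (forall x, u x <= v x) -> \int[P]_x u x <= \int[P]_x v x.
Proof.
by move=> bu bv uv; apply: le_Rintegral => //; exact: bounded_measurable_integrable.
Qed.

Lemma mean_sum (u : nat -> T -> R) n : (forall i, bounded_measurable (u i)) ->
  \int[P]_x (\sum_(i < n) u i x) = \sum_(i < n) \int[P]_x u i x.
Proof.
move=> bu; elim: n => [|n IH].
  by under eq_Rintegral do rewrite big_ord0; rewrite mean_cst big_ord0.
under eq_Rintegral do rewrite big_ord_recr/=.
by rewrite meanD ?IH ?big_ord_recr//; exact: bounded_measurable_sum.
Qed.

Lemma EFin_mean u : bounded_measurable u ->
  (\int[P]_x u x)%:E = (\int[P]_x (u x)%:E)%E.
Proof.
move=> bu; rewrite fineK//; apply: integrable_fin_num => //.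
exact: bounded_measurable_integrable.
Qed.

End BoundedMeasurable.

Lemma bounded_measurable_comp (R : realType) d d' (T : measurableType d)
    (T' : measurableType d') (f : T -> T') (u : T' -> R) :
  measurable_fun setT f -> bounded_measurable u -> bounded_measurable (u \o f).
Proof.
move=> mf [mu [M uM]]; split; first exact: measurableT_comp.
by exists M => x; exact: uM.
Qed.

Lemma mean_transport (R : realType) d d' (T : measurableType d)
    (T' : measurableType d') (P : probability T R) (Q : probability T' R)
    (f : T -> T') (u : T' -> R) : measurable_fun setT f ->
  (forall B, measurable B -> P (f @^-1` B) = Q B) -> bounded_measurable u ->
  \int[P]_x u (f x) = \int[Q]_x u x.
Proof.
move=> mf PQ bu; congr fine.
have bufi := bounded_measurable_integrable P (bounded_measurable_comp mf bu).
rewrite -(@eq_measure_integral _ _ _ setT Q (pushforward P f))//.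
  by rewrite (integral_pushforward mf)//; apply/measurable_EFinP; case: bu.
by move=> B mB _; exact: PQ.
Qed.

(** * Means of Birkhoff sums *)

Section Iterates.
Context (R : realType) d (T : measurableType d) (f : T -> T).
Hypothesis mf : measurable_fun setT f.

Lemma bounded_measurable_iter (u : T -> R) k : bounded_measurable u ->
  bounded_measurable (fun x => u (iter k f x)).
Proof.
move=> bu; elim: k => //= k IH; have := bounded_measurable_comp mf IH.
by congr bounded_measurable; apply/funext => x /=; rewrite -iterS iterSr.
Qed.

Lemma mean_sum_iter (P : probability T R) (u : T -> R) n :
  (forall B, measurable B -> P (f @^-1` B) = P B) -> bounded_measurable u ->
  \int[P]_x (\sum_(k < n) u (iter k f x)) = n%:R * \int[P]_x u x.
Proof.
move=> invP bu.
have iterP k : \int[P]_x u (iter k f x) = \int[P]_x u x.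
  elim: k => //= k <-.
  rewrite -(mean_transport mf invP (bounded_measurable_iter k bu)).
  by apply: eq_Rintegral => x _; rewrite -iterS iterSr.
rewrite (@mean_sum _ _ _ P (fun k x => u (iter k f x))); last first.
  by move=> k; exact: bounded_measurable_iter.
rewrite (eq_bigr (fun=> \int[P]_x u x)) => [|k _]; last exact: iterP.
by rewrite sumr_const card_ord mulr_natl.
Qed.

End Iterates.

(** * Hamming distance and duality *)

Section Hamming.
Context (R : realType) (S : finType) (A : S -> S -> bool) (x0 : sft A).
Local Notation X := (sft_space x0).
Local Notation h n := (@hamming S A x0 R n).
Implicit Types (x y z : X).

Definition mismatch (z : X * X) : R := (letter z.1 0 != letter z.2 0)%:R.

Lemma determined_mismatch : determined (@letter2 S A x0)
  [set z : X * X | letter z.1 0 != letter z.2 0].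
Proof.
by exists 1%N => z z' /(_ 0%N isT) [+ +] /=; rewrite /letter2 => -> ->.
Qed.

Lemma mismatchE : mismatch = \1_[set z | letter z.1 0 != letter z.2 0].
Proof.
apply/funext => z; rewrite indicE /mismatch; congr (_%:R); congr nat_of_bool.
by apply/idP/idP => [/mem_set|/set_mem].
Qed.

Lemma hammingE n x y :
  h n x y = n%:R^-1 * \sum_(i < n) (letter x i != letter y i)%:R.
Proof.
rewrite /hamming -sum1_card natr_sum big_mkcond/=; congr (_ * _).
by apply: eq_bigr => i _; rewrite inE; case: ifP.
Qed.

Lemma hamming_triangle n x y z : h n x z <= h n x y + h n y z.
Proof.
rewrite !hammingE -mulrDr ler_wpM2l ?invr_ge0//.
rewrite -big_split/=; apply: ler_sum => i _; rewrite -natrD ler_nat.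
by case: eqVneq => // xz; case: eqVneq => [<-|]; rewrite ?xz.
Qed.

Lemma hammingC n x y : h n x y = h n y x.
Proof.
by rewrite !hammingE; congr (_ * _); apply: eq_bigr => i _; rewrite eq_sym.
Qed.

Lemma hamming_agree n x y : agree (@letter S A x0) n x y -> h n x y = 0.
Proof.
by move=> xy; rewrite hammingE big1 ?mulr0// => i _; rewrite xy// eqxx.
Qed.

Lemma hamming_ge0 n x y : 0 <= h n x y.
Proof. by rewrite /hamming mulr_ge0 ?invr_ge0. Qed.

Lemma hamming_le1 n x y : h n x y <= 1.
Proof.
(* For [n = 0] the inverse of zero is zero by convention, and so is the distance. *)
rewrite /hamming; case: n => [|n]; first by rewrite invr0 mul0r.
by rewrite mulrC ler_pdivrMr ?ltr0Sn// mul1r ler_nat -[leqRHS]card_ord max_card.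
Qed.

Lemma iter_shift2 k (z : X * X) : iter k (@sft_shift2 S A x0) z =
  (iter k (@sft_shift S A x0) z.1, iter k (@sft_shift S A x0) z.2).
Proof. by case: z => x y; elim: k => //= k ->. Qed.

Lemma letter_iter k x i : letter (iter k (@sft_shift S A x0) x) i = letter x (k + i).
Proof.
elim: k i => //= k IH i; transitivity (letter (iter k (@sft_shift S A x0) x) i.+1) => //.
by rewrite IH addnS addSn.
Qed.

Lemma sum_mismatch n (z : X * X) : (0 < n)%N ->
  \sum_(k < n) mismatch (iter k (@sft_shift2 S A x0) z) = n%:R * h n z.1 z.2.
Proof.
move=> n0; rewrite hammingE mulrA divff ?pnatr_eq0 -?lt0n// mul1r.
by apply: eq_bigr => k _; rewrite iter_shift2 /mismatch/= !letter_iter addn0.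
Qed.

(** Points agreeing on [n] letters are at distance zero, so preimages under [phi] are determined; as
    the distance is at most 1, [phi] stays within [|r|] of its value at [point]. *)
Lemma hamming_lipschitz_bounded_measurable n (r : R) (phi : borel X -> R) :
  (forall x y, `|phi x - phi y| <= r * h n x y) -> bounded_measurable phi.
Proof.
move=> lip; split.
  move=> _ B _; rewrite setTI measurable_letterE; apply: sub_gen_smallest.
  exists n => x y xy; suff xy' : phi x = phi y by rewrite /preimage/= xy'.
  by apply/eqP; rewrite -subr_eq0 -normr_le0 (le_trans (lip _ _))// hamming_agree// mulr0.
exists (`|phi point| + `|r|) => x.
rewrite -[phi x](subrK (phi point)) addrC (le_trans (ler_normD _ _))// lerD2l.
rewrite (le_trans (lip _ _))// (le_trans (ler_norm _))// normrM ler_piMr//.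
by rewrite ger0_norm ?hamming_ge0// hamming_le1.
Qed.

End Hamming.

Section Duality.
Context (R : realType) (S : finType) (A : S -> S -> bool) (x0 : sft A).
Local Notation X := (sft_space x0).
Local Notation h n := (@hamming S A x0 R n).
Local Notation shift := (@sft_shift S A x0).
Local Notation shift2 := (@sft_shift2 S A x0).
Variables mu nu : probability (borel X) R.
Hypotheses (mu_inv : shift_invariant mu) (nu_inv : shift_invariant nu).
Variable s : R.
Hypothesis sP : forall phi, OmegaH x0 R phi ->
  \int[mu]_x phi x - \int[nu]_x phi x <= s.

(** Rescaling by [r^-1] gives an element of [OmegaH]; for [r = 0] the function is constant and its
    two means agree. *)
Lemma hamming_lipschitz_mean n (r : R) (phi : X -> R) : (0 < n)%N -> 0 <= r ->
  (forall x y, `|phi x - phi y| <= r * h n x y) ->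
  \int[mu]_x phi x - \int[nu]_x phi x <= r * s.
Proof.
move=> n0 + lip; have bphi := hamming_lipschitz_bounded_measurable lip.
rewrite le0r => /predU1P[r0|r0].
  have phiE x : phi x = phi point.
    by apply/eqP; rewrite -subr_eq0 -normr_le0 (le_trans (lip _ _))// r0 mul0r.
  rewrite r0 mul0r (@eq_Rintegral _ _ _ mu _ (fun=> phi point))//.
  rewrite (@eq_Rintegral _ _ _ nu _ (fun=> phi point))//.
  by rewrite !mean_cst subrr.
have := sP (phi := fun x => r^-1 * phi x).
rewrite !meanZ// -mulrBr ler_pdivrMl//; apply.
exists n => // x y; rewrite -mulrBr normrM gtr0_norm ?invr_gt0//.
by rewrite ler_pdivrMl.
Qed.

(* Averaging over [n] iterates of the shift makes the coboundary [G o T - G]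
   negligible and turns the mismatch at the first letter into the Hamming
   distance; the [c]-transform of the averaged [v] is then a test function. *)
Lemma dual_ge0 (G : X * X -> R) (u v : borel X -> R) (t : R) : 0 <= t ->
  (exists M, forall z, `|G z| <= M) ->
  bounded_measurable u -> bounded_measurable v ->
  (forall z, G (shift2 z) - G z <= u z.1 + v z.2 + t * mismatch R z) ->
  0 <= \int[mu]_x u x + \int[nu]_x v x + t * s.
Proof.
move=> t0 [M GM] bu bv Guv.
set K := (X in 0 <= X).
(* A lower bound on [n%:R * K] uniform in [n] forces [0 <= K] by the Archimedean property. *)
suff Kn n : (0 < n)%N -> - (2 * M) <= n%:R * K.
  rewrite leNgt; apply/negP => K0.
  have M0 : 0 <= M by exact: le_trans (GM point).
  pose n := (Num.bound (2 * M / - K)).+1.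
  have : 2 * M / - K < n%:R.
    rewrite (lt_trans (archi_boundP _)) ?ltr_nat//.
    by rewrite divr_ge0 ?mulr_ge0// oppr_ge0 ltW.
  rewrite ltr_pdivrMr ?oppr_gt0// mulrN.
  by have := Kn n isT; lra.
move=> n0.
pose U x := \sum_(k < n) u (iter k shift x).
pose V x := \sum_(k < n) v (iter k shift x).
have bU : @bounded_measurable _ (borel X) R U.
  apply: (@bounded_measurable_sum _ _ (borel X) (fun k x => u (iter k shift x))).
  by move=> k; apply: (bounded_measurable_iter (@measurable_shift S A x0)).
have bV : @bounded_measurable _ (borel X) R V.
  apply: (@bounded_measurable_sum _ _ (borel X) (fun k x => v (iter k shift x))).
  by move=> k; apply: (bounded_measurable_iter (@measurable_shift S A x0)).
(* Summed along the orbit, the coboundary telescopes to a difference of two values of [G], whence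
   the constant [2 * M]. *)
have telescope x y : - (2 * M) <= U x + V y + t * n%:R * h n x y.
  have : G (iter n shift2 (x, y)) - G (x, y) <=
      \sum_(k < n) (u (iter k shift x) + v (iter k shift y) +
        t * mismatch R (iter k shift2 (x, y))).
    elim: (n) => [|k IH]; first by rewrite big_ord0 subrr.
    rewrite big_ord_recr/=.
    have it1 : (iter k shift2 (x, y)).1 = iter k shift x by rewrite iter_shift2.
    have it2 : (iter k shift2 (x, y)).2 = iter k shift y by rewrite iter_shift2.
    by have := Guv (iter k shift2 (x, y)); rewrite it1 it2; lra.
  rewrite !big_split/= -mulr_sumr sum_mismatch// mulrA.
  have := GM (iter n shift2 (x, y)); have := GM (x, y); rewrite !ler_norml.
  by rewrite -/(U x) -/(V y); lra.
pose D x := [set V y + t * n%:R * h n x y | y in setT].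
have hD x : has_inf (D x).
  split; first by exists (V point + t * n%:R * h n x point), point.
  exists (- (2 * M) - U x) => _ [y _ <-].
  by have := telescope x y; lra.
pose phi x := inf (D x).
have phi_le x y : phi x <= V y + t * n%:R * h n x y.
  by apply: ge_inf; [case: (hD x)|exists y].
have phi_ge x (a : R) : (forall y, a <= V y + t * n%:R * h n x y) -> a <= phi x.
  by move=> aP; apply: lb_le_inf => [|_ [y _ <-]//]; case: (hD x).
have tn0 : 0 <= t * n%:R by rewrite mulr_ge0.
(* The triangle inequality passes to the infimum, so [phi] inherits the Lipschitz constant of the
   distance term. *)
have phi_sub x x' : phi x - t * n%:R * h n x x' <= phi x'.
  apply: phi_ge => y; have := phi_le x y.
  have := ler_wpM2l tn0 (hamming_triangle R n x x' y); rewrite mulrDr; lra.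
have lip x y : `|phi x - phi y| <= t * n%:R * h n x y.
  rewrite ler_norml; have := phi_sub x y; have := phi_sub y x.
  by rewrite (hammingC R n y x) => *; apply/andP; split; lra.
have bphi := hamming_lipschitz_bounded_measurable lip.
have mphi := hamming_lipschitz_mean n0 tn0 lip.
have Uphi : - (2 * M) <= \int[mu]_x U x + \int[mu]_x phi x.
  rewrite -meanD// -(mean_cst mu (- (2 * M))).
  apply: le_mean => [||x]; [exact: bounded_measurable_cst|exact: bounded_measurableD|].
  by rewrite -lerBlDl; apply: phi_ge => y; have := telescope x y; lra.
have Vphi : \int[nu]_x phi x <= \int[nu]_x V x.
  apply: le_mean => // y; have := phi_le y y.
  by rewrite hamming_agree// mulr0 addr0.
have EU : \int[mu]_x U x = n%:R * \int[mu]_x u x.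
  exact: (@mean_sum_iter _ _ (borel X) _ (@measurable_shift S A x0) mu u n mu_inv bu).
have EV : \int[nu]_x V x = n%:R * \int[nu]_x v x.
  exact: (@mean_sum_iter _ _ (borel X) _ (@measurable_shift S A x0) nu v n nu_inv bv).
(* The mean of [U + phi] under [mu] is at least [- (2 * M)]. Passing from [mu] to [nu] in the mean
   of [phi] costs at most [t * n%:R * s], and [V] then replaces [phi], for a total of [n%:R * K]. *)
by move: Uphi Vphi mphi; rewrite /K EU EV 2!mulrDr (mulrA n%:R) (mulrC n%:R t); lra.
Qed.

End Duality.

(** * The vector space of bounded functions *)

Section BoundedFunctions.
Context (T : Type) (R : realType).

Definition bounded_function : {pred T -> R} :=
  [pred F | `[< exists M, forall x, `|F x| <= M >]].

Lemma bounded_functionP (F : T -> R) :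
  reflect (exists M, forall x, `|F x| <= M) (F \in bounded_function).
Proof. exact: asboolP. Qed.

Lemma bounded_function_submod : submod_closed bounded_function.
Proof.
split; first by apply/bounded_functionP; exists 0 => x; rewrite normr0.
move=> a F G /bounded_functionP[M FM] /bounded_functionP[N GN].
apply/bounded_functionP; exists (`|a| * M + N) => x.
by rewrite (le_trans (ler_normD _ _))// lerD// normrM ler_wpM2l.
Qed.

HB.instance Definition _ := GRing.isSubmodClosed.Build R (T -> R)
  bounded_function bounded_function_submod.

Record bounded_fun := BoundedFun {
  bounded_fun_val :> T -> R; bounded_funP : bounded_fun_val \in bounded_function }.

HB.instance Definition _ := [isSub for bounded_fun_val].
HB.instance Definition _ := [Choice of bounded_fun by <:].
HB.instance Definition _ := [SubChoice_isSubLmodule of bounded_fun by <:].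

(** [L] is defined on all functions, with the value at [0] as default for unbounded ones; hence the
    boundedness conditions in its properties. *)
Lemma hahn_banach_bounded (p : (T -> R) -> R) :
  (forall F G, F \in bounded_function -> G \in bounded_function ->
    p (F + G) <= p F + p G) ->
  (forall a F, 0 <= a -> F \in bounded_function -> p (a *: F) <= a * p F) ->
  exists L : (T -> R) -> R, [/\
    forall F G, F \in bounded_function -> G \in bounded_function ->
      L (F + G) = L F + L G,
    forall F, F \in bounded_function -> L (- F) = - L F
    & forall F, F \in bounded_function -> L F <= p F].
Proof.
move=> pD pZ.
have [|f [fD fZ fp]] := @hahn_banach R bounded_fun (p \o bounded_fun_val).
  by split=> [F G|a F a0] /=; [apply: pD|apply: pZ => //]; exact: bounded_funP.
exists (fun F => f (insubd (0 : bounded_fun) F)); split=> [F G bF bG|F bF|F bF].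
- rewrite -fD; congr f; apply: val_inj.
  by rewrite /= !val_insubd bF bG rpredD.
- rewrite -[RHS]mulN1r -fZ; congr f; apply: val_inj.
  by rewrite /= !val_insubd rpredN bF scaleN1r.
- have := fp (insubd (0 : bounded_fun) F).
  by rewrite /= -[bounded_fun_val _]/(val _) val_insubd bF.
Qed.

Lemma indic_bounded_function (B : set T) : \1_B \in bounded_function.
Proof.
apply/bounded_functionP; exists 1 => x.
by rewrite /indic ger0_norm//; case: (_ \in _).
Qed.

End BoundedFunctions.

(** * Couplings *)

(** Determined sets are stable under intersection and generate the sigma-algebra, so finite measures
    agreeing on them coincide. *)
Lemma determined_transport (R : realType) d d' (T : measurableType d)
    (T' : measurableType d') (W : finType) (code : T' -> nat -> W)
    (P : probability T R) (Q : probability T' R) (f : T -> T') :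
  measurable_fun setT f -> @measurable _ T' = <<s determined code >> ->
  (forall B, determined code B -> P (f @^-1` B) = Q B) ->
  forall B, measurable B -> P (f @^-1` B) = Q B.
Proof.
move=> mf mE PQ B mB.
apply: (@measure_unique _ R T' (determined code) (fun=> setT) mE _ _ _
  (pushforward P f) Q) => //.
- exact: determinedI.
- by move=> _; exists 0%N.
- by rewrite bigcup_const//; exists 0%N.
- by move=> _; apply: le_lt_trans (probability_le1 P _) (ltry _); exact: measurableT.
Qed.

Lemma mean_indic (R : realType) d (T : measurableType d) (P : probability T R)
    (B : set T) : measurable B -> \int[P]_x \1_B x = fine (P B).
Proof. by move=> mB; rewrite /Rintegral integral_indic// setIT. Qed.

Lemma bounded_measurable_indic (R : realType) d (T : measurableType d)
    (B : set T) : measurable B -> bounded_measurable (\1_B : T -> R).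
Proof.
move=> mB; split; first exact: measurable_indic.
by exists 1 => x; rewrite /indic ger0_norm//; case: (_ \in _).
Qed.

Section Coupling.
Context (R : realType) (S : finType) (A : S -> S -> bool) (x0 : sft A).
Local Notation X := (sft_space x0).
Local Notation shift := (@sft_shift S A x0).
Local Notation shift2 := (@sft_shift2 S A x0).
Variables mu nu : probability (borel X) R.
Hypotheses (mu_inv : shift_invariant mu) (nu_inv : shift_invariant nu).
Variable s : R.
Hypothesis sP : forall phi, OmegaH x0 R phi ->
  \int[mu]_x phi x - \int[nu]_x phi x <= s.
Implicit Types (F G : X * X -> R) (u v : borel X -> R) (r t : R).

(* The dual problem for the transport of [mu] to [nu] by invariant couplings:
   [u] and [v] are the potentials of the marginal constraints, [G] is the
   multiplier of the invariance constraint and [t] that of the cost bound. *)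
Definition dominated F : set R := [set r | exists G u v t,
  [/\ 0 <= t, G \in @bounded_function _ R, bounded_measurable u,
      bounded_measurable v
    & forall z, F z + (G (shift2 z) - G z) <= u z.1 + v z.2 + t * mismatch R z]
  /\ r = \int[mu]_x u x + \int[nu]_x v x + t * s].

(** Since [F >= - M], adding the constant [M] to [u] absorbs [F], and [dual_ge0] applies to what
    remains. *)
Lemma dominated_ge F M r : (forall z, `|F z| <= M) -> dominated F r -> - M <= r.
Proof.
move=> FM [G [u [v [t [[t0 /bounded_functionP bG bu bv Fle] ->]]]]].
have bM := bounded_measurable_cst (borel X) M.
have := dual_ge0 mu_inv nu_inv sP t0 bG (bounded_measurableD bM bu) bv.
rewrite meanD// mean_cst => /(_ _)/wrap[z|]; last lra.
by have := Fle z; have := FM z; rewrite ler_norml; lra.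
Qed.

Lemma dominated_has_inf F : F \in @bounded_function _ R -> has_inf (dominated F).
Proof.
move=> /bounded_functionP[M FM]; split; last first.
  by exists (- M) => r; exact: dominated_ge.
(* The bound [M] serves as first potential, with all other multipliers zero. *)
exists (M + 0 + 0 * s), (fun=> 0), (fun=> M), (fun=> 0), 0; split; last first.
  by rewrite !mean_cst.
split=> //; [by rewrite rpred0|exact: bounded_measurable_cst..|].
by move=> z; have := FM z; rewrite ler_norml; lra.
Qed.

Lemma dominatedD F G r t :
  dominated F r -> dominated G t -> dominated (F + G) (r + t).
Proof.
move=> [F1 [u1 [v1 [t1 [[t10 bF1 bu1 bv1 le1] ->]]]]].
move=> [F2 [u2 [v2 [t2 [[t20 bF2 bu2 bv2 le2] ->]]]]].
exists (F1 + F2), (fun x => u1 x + u2 x), (fun x => v1 x + v2 x), (t1 + t2).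
split; last by rewrite !meanD//; lra.
split; [exact: addr_ge0|exact: rpredD|exact: bounded_measurableD..|].
move=> z; have := le1 z; have := le2 z; rewrite !fctE; lra.
Qed.

Lemma dominatedZ F a r : 0 <= a -> dominated F r -> dominated (a *: F) (a * r).
Proof.
move=> a0 [G [u [v [t [[t0 bG bu bv Fle] ->]]]]].
exists (a *: G), (fun x => a * u x), (fun x => a * v x), (a * t).
split; last by rewrite !meanZ//; lra.
split; [exact: mulr_ge0|exact: rpredZ|exact: bounded_measurableZ..|].
move=> z; rewrite -![(a *: _) _]/(a * _).
by have := ler_wpM2l a0 (Fle z); lra.
Qed.

(** Hahn-Banach is applied to the infimum of [dominated]; every dual certificate [(G, u, v, t)] then
    becomes an inequality for [L]. *)
Lemma invariant_mean : exists L : (X * X -> R) -> R, [/\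
    forall F G, F \in @bounded_function _ R -> G \in @bounded_function _ R ->
      L (F + G) = L F + L G,
    forall F, F \in @bounded_function _ R -> L (- F) = - L F
    & forall F r, F \in @bounded_function _ R -> dominated F r -> L F <= r].
Proof.
have [F G bF bG|a F a0 bF|L [LD LN Lp]] :=
    @hahn_banach_bounded _ R (fun F => inf (dominated F)).
- have iF := dominated_has_inf bF; have iG := dominated_has_inf bG.
  have iFG := dominated_has_inf (rpredD bF bG).
  rewrite -lerBlDr; apply: lb_le_inf; first by case: iF.
  move=> r rF; rewrite lerBlDr -lerBlDl; apply: lb_le_inf; first by case: iG.
  move=> t tG; rewrite lerBlDl; apply: ge_inf; first by case: iFG.
  exact: dominatedD.
- apply: le_mul_inf => //; first exact: dominated_has_inf.
  move=> r rF; apply: ge_inf; last exact: dominatedZ.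
  by case: (dominated_has_inf (rpredZ a bF)).
- exists L; split=> // F r bF Fr; rewrite (le_trans (Lp _ bF))//.
  by apply: ge_inf => //; case: (dominated_has_inf bF).
Qed.

(** Positivity, marginals, invariance and cost of the set function [m] all come from explicit
    certificates [(G, u, v, t)]; compactness then turns [m] into a measure. *)
Lemma joining_le_cost : exists theta, is_joining mu nu theta /\
  (theta [set z | letter z.1 0%N != letter z.2 0%N] <= s%:E)%E.
Proof.
have [L [LD LN Lle]] := invariant_mean.
pose b (B : set (X * X)) := @indic_bounded_function _ R B : \1_B \in @bounded_function _ R.
have b0 : (fun=> 0) \in @bounded_function (X * X) R by exact: rpred0.
have LB F G r : F \in @bounded_function _ R -> G \in @bounded_function _ R ->
    dominated (F - G) r -> L F - L G <= r.
  by move=> bF bG FG; rewrite -LN// -LD ?rpredN// Lle ?rpredB.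
have cst0 := bounded_measurable_cst (R := R) (borel X) 0.
pose m B := L \1_B.
have m_ge0 B : 0 <= m B.
  rewrite /m -oppr_le0 -LN//; apply: (Lle (- \1_B)); first by rewrite rpredN.
  exists (fun=> 0), (fun=> 0), (fun=> 0), 0; split; last by rewrite !mean_cst; lra.
  by split=> // z; rewrite !fctE /indic; case: (_ \in _) => /=; lra.
have m_fst (B : set (borel X)) : measurable B -> (m (fst @^-1` B))%:E = mu B.
  move=> mB; rewrite -[RHS]fineK ?fin_num_measure// -mean_indic//; congr (_%:E).
  have ind z : \1_(fst @^-1` B) z = \1_B z.1 :> R by [].
  have bB := bounded_measurable_indic R mB.
  apply/eqP; rewrite eq_le; apply/andP; split.
    (* The potential [\1_B] gives the upper bound, its opposite the lower one. *)
    apply: (Lle \1_(fst @^-1` B)) => //; exists (fun=> 0), (\1_B), (fun=> 0), 0.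
    split; last by rewrite mean_cst; lra.
    by split=> // z; rewrite ind; lra.
  rewrite /m -lerN2 -LN//; apply: (Lle (- \1_(fst @^-1` B))); first by rewrite rpredN.
  exists (fun=> 0), (fun x => -1 * \1_B x), (fun=> 0), 0.
  split; last by rewrite mean_cst meanZ//; lra.
  split=> //; first exact: bounded_measurableZ.
  by move=> z; rewrite !fctE ind; lra.
have m_snd (B : set (borel X)) : measurable B -> (m (snd @^-1` B))%:E = nu B.
  move=> mB; rewrite -[RHS]fineK ?fin_num_measure// -mean_indic//; congr (_%:E).
  have ind z : \1_(snd @^-1` B) z = \1_B z.2 :> R by [].
  have bB := bounded_measurable_indic R mB.
  apply/eqP; rewrite eq_le; apply/andP; split.
    apply: (Lle \1_(snd @^-1` B)) => //; exists (fun=> 0), (fun=> 0), (\1_B), 0.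
    split; last by rewrite mean_cst; lra.
    by split=> // z; rewrite ind; lra.
  rewrite /m -lerN2 -LN//; apply: (Lle (- \1_(snd @^-1` B))); first by rewrite rpredN.
  exists (fun=> 0), (fun=> 0), (fun x => -1 * \1_B x), 0.
  split; last by rewrite mean_cst meanZ//; lra.
  split=> //; first exact: bounded_measurableZ.
  by move=> z; rewrite !fctE ind; lra.
have mT : m setT = 1.
  have := m_fst setT measurableT; rewrite preimage_setT => e.
  by apply: EFin_inj; rewrite e; exact: probability_setT.
have mU B C : B `&` C = set0 -> m (B `|` C) = m B + m C.
  move=> BC; rewrite /m -LD//; congr L; apply/funext => z.
  rewrite !fctE !indicE in_setU -natrD; congr (_%:R).
  have : ~ (z \in B /\ z \in C).
    by case=> /set_mem zB /set_mem zC; rewrite -[False]/(set0 z) -BC.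
  by case: (z \in B) (z \in C) => [] [] // []; split.
have m_inv B : m (shift2 @^-1` B) = m B.
  apply/eqP; rewrite eq_le -[X in X && _]subr_le0 -[X in _ && X]subr_le0; apply/andP; split.
    apply: (LB \1_(shift2 @^-1` B) \1_B) => //.
    (* The difference of the two indicators is the coboundary of [\1_B], which the multiplier
       [- \1_B] cancels. *)
    exists (- \1_B), (fun=> 0), (fun=> 0), 0.
    split; last by rewrite !mean_cst; lra.
    by split=> //; [rewrite rpredN|move=> z; rewrite !fctE !indicE; lra].
  apply: (LB \1_B \1_(shift2 @^-1` B)) => //.
  exists (\1_B), (fun=> 0), (fun=> 0), 0.
  split; last by rewrite !mean_cst; lra.
  by split=> // z; rewrite !fctE !indicE; lra.
have [theta thetaE] := @content_extension R _ (borel (X * X)%type) _ _ m m_ge0 mT mU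
  (@letter2_complete S A x0) (measurable_letter2E x0).
(* [theta] is tied to [m] on determined sets; uniqueness of measures carries the three identities
   over to Borel sets. *)
exists theta; split; first split.
- apply: (determined_transport (@measurable_shift2 S A x0) (measurable_letter2E x0)).
  move=> B dB; rewrite thetaE; last exact: determined_shift2.
  by rewrite thetaE// m_inv.
- apply: (determined_transport (@measurable_sft_fst S A x0) (measurable_letterE x0)).
  move=> B dB; rewrite thetaE; last exact: determined_fst.
  by rewrite m_fst// measurable_letterE; exact: sub_gen_smallest.
- apply: (determined_transport (@measurable_sft_snd S A x0) (measurable_letterE x0)).
  move=> B dB; rewrite thetaE; last exact: determined_snd.
  by rewrite m_snd// measurable_letterE; exact: sub_gen_smallest.
rewrite thetaE; last exact: determined_mismatch.
rewrite lee_fin; apply: Lle => //.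
(* With [t = 1] the mismatch is dominated at the price [s]. *)
exists (fun=> 0), (fun=> 0), (fun=> 0), 1; split; last by rewrite !mean_cst; lra.
by split=> // z; rewrite mismatchE; lra.
Qed.

End Coupling.

(** * Lower bound on the cost of a joining *)

Section JoiningLowerBound.
Context (R : realType) (S : finType) (A : S -> S -> bool) (x0 : sft A).
Local Notation X := (sft_space x0).
Local Notation c := (@mismatch R S A x0).
Local Notation C := [set z : X * X | letter z.1 0 != letter z.2 0].

Lemma joining_ge_mean (mu nu : probability (borel X) R) theta (phi : X -> R) :
  is_joining mu nu theta -> OmegaH x0 R phi ->
  \int[mu]_x phi x - \int[nu]_x phi x <= fine (theta C).
Proof.
move=> [theta_inv theta1 theta2] [n /= n0 lip].
have mC : @measurable _ (borel (X * X)%type) C.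
  by rewrite measurable_letter2E; apply: sub_gen_smallest; exact: determined_mismatch.
have bphi : bounded_measurable (phi : borel X -> R).
  by apply: (@hamming_lipschitz_bounded_measurable _ _ _ _ n 1) => x y; rewrite mul1r; exact: lip.
have bm : @bounded_measurable _ (borel (X * X)%type) R (c).
  by rewrite mismatchE; exact: bounded_measurable_indic.
pose Sc z := \sum_(k < n) c (iter k (@sft_shift2 S A x0) z).
have bS : @bounded_measurable _ (borel (X * X)%type) R Sc.
  apply: (@bounded_measurable_sum _ _ (borel (X * X)%type)
    (fun k z => c (iter k (@sft_shift2 S A x0) z))) => k.
  exact: (bounded_measurable_iter (@measurable_shift2 S A x0)).
have bh := bounded_measurableZ n%:R^-1 bS.
have b1 := bounded_measurable_comp (@measurable_sft_fst S A x0) bphi.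
have b2 := bounded_measurable_comp (@measurable_sft_snd S A x0) bphi.
rewrite -(mean_transport (@measurable_sft_fst S A x0) theta1 bphi).
rewrite -(mean_transport (@measurable_sft_snd S A x0) theta2 bphi).
rewrite -mean_indic// -mismatchE lerBlDl.
(* By invariance of [theta], averaging the mismatch over [n] iterates keeps its mean; the average is
   the Hamming distance, to which [lip] applies. *)
have -> : \int[theta]_z c z = \int[theta]_z (n%:R^-1 * Sc z).
  rewrite meanZ// (@mean_sum_iter _ _ _ _ (@measurable_shift2 S A x0) theta c n)//.
  by rewrite mulrA mulVf ?mul1r// pnatr_eq0 -lt0n.
rewrite -meanD//; apply: le_mean => //; first exact: bounded_measurableD.
move=> z /=; rewrite /Sc sum_mismatch// mulKf ?pnatr_eq0 -?lt0n//.
by have := lip z.1 z.2; rewrite ler_norml; lra.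
Qed.

End JoiningLowerBound.

(** * The duality formula for the d-bar distance *)

Local Open Scope ereal_scope.

Theorem theorem2 (R : realType) (S : finType) (A : S -> S -> bool)
    (mixA : mixing A) (x0 : sft A)
    (mu nu : probability (borel (sft_space x0)) R)
    (mu_inv : shift_invariant mu) (nu_inv : shift_invariant nu) :
  dbar mu nu =
  ereal_sup [set `| \int[mu]_x (phi x)%:E - \int[nu]_x (phi x)%:E |
            | phi in OmegaH x0 R].
Proof.
have bphi phi : OmegaH x0 R phi ->
    bounded_measurable (phi : borel (sft_space x0) -> R).
  move=> [n _ lip]; apply: (@hamming_lipschitz_bounded_measurable _ _ _ _ n 1).
  by move=> x y; rewrite mul1r; exact: lip.
have meanE phi : OmegaH x0 R phi ->
    `| \int[mu]_x (phi x)%:E - \int[nu]_x (phi x)%:E | =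
    (`| \int[mu]_x phi x - \int[nu]_x phi x |%R)%:E.
  by move=> /bphi bp; rewrite -!EFin_mean.
apply/eqP; rewrite eq_le; apply/andP; split; last first.
  apply: ge_ereal_sup => _ [phi Ophi <-]; apply: le_ereal_inf_tmp => _ [theta J <-].
  rewrite meanE// -[leRHS]fineK ?fin_num_measure//; last first.
    rewrite measurable_letter2E; apply: sub_gen_smallest.
    exact: determined_mismatch.
  (* The mean bound is one-sided; the opposite of [phi] supplies the other half of the absolute
     value. *)
  have ON : OmegaH x0 R (fun x => -1 * phi x)%R.
    case: Ophi => n n0 lip; exists n => // x y.
    by rewrite -mulrBr normrM normrN1 mul1r; exact: lip.
  have := joining_ge_mean J Ophi; have := joining_ge_mean J ON.
  rewrite !meanZ; [|exact: bphi..].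
  by move=> h1 h2; rewrite lee_fin ler_norml; apply/andP; split; lra.
set s := ereal_sup _.
have s_ge phi : OmegaH x0 R phi ->
    (\int[mu]_x phi x - \int[nu]_x phi x)%:E <= s.
  move=> Ophi; apply: (@le_trans _ _ `|\int[mu]_x phi x - \int[nu]_x phi x|%:E).
    by rewrite lee_fin ler_norm.
  by apply: ereal_sup_ubound; exists phi => //; rewrite meanE.
(* The zero function excludes the value [-oo] of the supremum; at [+oo] the inequality is trivial,
   which leaves a real [r]. *)
have O0 : OmegaH x0 R (fun=> 0%R).
  by exists 1%N => // x y; rewrite subrr normr0 hamming_ge0.
case Es : s => [r| |]; last 2 first.
- by rewrite leey.
- by have := s_ge _ O0; rewrite Es leeNy_eq.
have [|theta [J cost]] := joining_le_cost mu_inv nu_inv (s := r).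
  by move=> phi /s_ge; rewrite Es lee_fin.
by apply: le_trans cost; apply: ereal_inf_lbound; exists theta.
Qed.
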